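(* Let $\mathcal{E}=\mathcal{Q}_0$ be the ellipsoid $\frac{x_1^2}{a_1}+\dots+\frac{x_d^2}{a_d}=1$ in $\mathbf{E}^{k,l}$. Then: \begin{itemize} \item[(PE1)] each point inside $\mathcal{E}$ is the intersection of exactly $d$ quadrics from the confocal family $(\mathcal{Q}_\lambda)$; moreover, all these quadrics are of different relativistic types; \item[(PE2)] the types of these quadrics are $E$, $H^1$, \dots, $H^{d-1}$ -- each type corresponds to one of the disjoint intervals of the parameter $\lambda$: $$(-a_d,-a_{d-1}),\ (-a_{d-1},-a_{d-2}),\ \dots,\ (-a_{k+1},0),\ (0,a_k),\ (a_k,a_{k-1}),\ \dots,\ (a_2,a_1).$$ \end{itemize}
   Context: Let $k,l\ge1$, $d=k+l$. The pseudo-Euclidean space $\mathbf{E}^{k,l}$ is $\mathbf{R}^d$ with the scalar product $\langle x,y\rangle_{k,l}=x_1y_1+\dots+x_ky_k-x_{k+1}y_{k+1}-\dots-x_dy_d$. Fix positive constants $a_1,\dots,a_d$ with $a_1>\dots>a_k>0>-a_{k+1}>\dots>-a_d$. The confocal family is $$\mathcal{Q}_\lambda:\ \frac{x_1^2}{a_1-\lambda}+\dots+\frac{x_k^2}{a_k-\lambda}+\frac{x_{k+1}^2}{a_{k+1}+\lambda}+\dots+\frac{x_d^2}{a_d+\lambda}=1,\qquad\lambda\in\mathbf{R},$$ where for $\lambda\in\{a_1,\dots,a_k,-a_{k+1},\dots,-a_d\}$ the quadric is degenerate and coincides with the corresponding coordinate hyperplane. A point is inside $\mathcal{E}$ if $\sum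 x_i^2/a_i<1$. The generalized Jacobi coordinates of a point $x$ are the unordered $d$-tuple of solutions $\lambda$ of the equation of $\mathcal{Q}_\lambda$ at $x$ (roots of the polynomial obtained by clearing denominators; at least $d-2$ of them are real). Let $\Sigma_d\subset\mathbf{R}^d$ be the set of points where this equation has multiple solutions. $\Sigma_d$ divides each quadric of the family into several connected components, called relativistic quadrics. A relativistic quadric placed on $\mathcal{Q}_{\lambda_0}$ is: of type $E$ if at each of its points $\lambda_0$ is smaller than the other $d-1$ generalized Jacobi coordinates; of type $H^i$ ($1\le i\le d-1$) if at each of its points $\lambda_0$ is greater than $i$ other generalized Jacobi coordinates and smaller than $d-i-1$ of them; of type $0^i$ ($0\le i\le d-2$) if at each of its points $\lambda_0$ is greater than $i$ other real generalized Jacobi coordinates and smaller than $d-i-2$ of them. The type of a quadric at a point is the type of the relativistic quadric containing that point.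
   Formalization: Points of Σ_d inside the ellipsoid (multiple roots, so fewer than d quadrics) are excluded from the claims on d distinct quadrics, types and intervals; at all inside points the d roots are real. For degenerate quadrics the parameter is only placed in the closed interval. *)

(* Defs.v *)
From HB Require Import structures.
From mathcomp Require Import all_boot all_order all_algebra.
From mathcomp Require Import complex.
From mathcomp Require Import all_classical all_reals all_analysis.
Set Implicit Arguments.
Unset Strict Implicit.
Unset Printing Implicit Defensive.
Import Order.TTheory GRing.Theory Num.Theory.
Import numFieldNormedType.Exports.
Local Open Scope classical_set_scope.
Local Open Scope ring_scope.

(* Points of E^{k,l} are row vectors of size k + l and the indices 1, ..., d of
   the mathematical text become 0, ..., k + l - 1: the space-like coordinates
   are those of index < k. *)

(* Diagonal of the Gram matrix of the scalar product <x, y>_{k,l}. *)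
Definition signature (R : realType) (k l : nat) (i : 'I_(k + l)) : R :=
  if (i < k)%N then 1 else -1.

(* Parameter of the degenerate quadric {x_i = 0}: a_i for the first k indices,
   - a_i for the others. *)
Definition pole (R : realType) (k l : nat) (a : 'I_(k + l) -> R)
    (i : 'I_(k + l)) : R :=
  signature R i * a i.

Definition admissible (R : realType) (k l : nat) (a : 'I_(k + l) -> R) : Prop :=
  (forall i, 0 < a i) /\
  (forall i j : 'I_(k + l), (i < j)%N -> pole a j < pole a i).

Definition degenerate (R : realType) (k l : nat) (a : 'I_(k + l) -> R)
    (lam : R) : Prop :=
  exists i, lam = pole a i.

Definition confocal (R : realType) (k l : nat) (a : 'I_(k + l) -> R)
    (lam : R) : set 'rV[R]_(k + l) :=
  [set x | if [pick i | lam == pole a i] is Some i then x ord0 i = 0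
           else \sum_i x ord0 i ^+ 2 / (a i - signature R i * lam) = 1].

Definition inside_ellipsoid (R : realType) (k l : nat) (a : 'I_(k + l) -> R) :
    set 'rV[R]_(k + l) :=
  [set x | \sum_i x ord0 i ^+ 2 / a i < 1].

(* The equation of Q_lambda at x multiplied by all the denominators, as a
   polynomial of degree k + l in lambda. *)
Definition confocal_poly (R : realType) (k l : nat) (a : 'I_(k + l) -> R)
    (x : 'rV[R]_(k + l)) : {poly R} :=
  \sum_i x ord0 i ^+ 2 *:
      \prod_(j | j != i) ((a j)%:P - signature R j *: 'X)
  - \prod_j ((a j)%:P - signature R j *: 'X).

(* All complex roots, with multiplicity; only the multiset is meaningful. *)
Definition gen_jacobi (R : realType) (k l : nat) (a : 'I_(k + l) -> R)
    (x : 'rV[R]_(k + l)) : seq R[i] :=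
  sval (closed_field_poly_normal
          (map_poly (real_complex R) (confocal_poly a x))).

Definition discriminant_set (R : realType) (k l : nat) (a : 'I_(k + l) -> R) :
    set 'rV[R]_(k + l) :=
  [set x | ~~ uniq (gen_jacobi a x)].

Definition relativistic_quadric (R : realType) (k l : nat)
    (a : 'I_(k + l) -> R) (lam : R) (S : set 'rV[R]_(k + l)) : Prop :=
  exists2 x, (confocal a lam `\` discriminant_set a) x &
    S = connected_component (confocal a lam `\` discriminant_set a) x.

Inductive rtype := TypeE | TypeH of nat | Type0 of nat.

(* On R[i], z < w means that w - z is a positive real number, so that a
   non-real coordinate is neither smaller nor greater than a real parameter.
   Off the discriminant set, lam occurs once among the coordinates of a point
   of S, and the strict comparisons discard it: they only count the others.
   The counts i and d - i - 2 of Type0 are the source's. *)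
Definition has_type (R : realType) (k l : nat) (a : 'I_(k + l) -> R)
    (lam : R) (S : set 'rV[R]_(k + l)) (T : rtype) : Prop :=
  let lamC := real_complex R lam in
  let below x := count (fun z => z < lamC) (gen_jacobi a x) in
  let above x := count (fun z => lamC < z) (gen_jacobi a x) in
  let d := (k + l)%N in
  match T with
  | TypeE => forall x, S x -> above x = (d - 1)%N
  | TypeH i => (1 <= i <= d - 1)%N /\
      forall x, S x -> below x = i /\ above x = (d - i - 1)%N
  | Type0 i => (0 <= i <= d - 2)%N /\
      forall x, S x -> below x = i /\ above x = (d - i - 2)%N
  end.

Definition type_at (R : realType) (k l : nat) (a : 'I_(k + l) -> R)
    (lam : R) (x : 'rV[R]_(k + l)) (T : rtype) : Prop :=
  exists S, [/\ relativistic_quadric a lam S, S x & has_type a lam S T].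

(* The list E, H^1, H^2, ..., numbered from 0. *)
Definition EHtype (j : nat) : rtype := if j is 0 then TypeE else TypeH j.

(* - a_d, ..., - a_{k+1}, 0, a_k, ..., a_1. *)
Definition endpoints (R : realType) (k l : nat) (a : 'I_(k + l) -> R) : seq R :=
  rev ([seq a (lshift l i) | i <- enum 'I_k] ++
       0 :: [seq - a (rshift k j) | j <- enum 'I_l]).

Definition endpoint (R : realType) (k l : nat) (a : 'I_(k + l) -> R)
    (j : nat) : R :=
  nth 0 (endpoints a) j.

(* Main.v *)
(* Inside the ellipsoid the polynomial obtained by clearing denominators has
   weakly alternating signs at the d + 1 points - a_d, ..., - a_{k+1}, 0, a_k,
   ..., a_1: its value at a pole carries the factor x_i^2 >= 0, and its value at
   0 is negative.  Hence it splits over the reals with exactly one root attached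
   to each of the d consecutive intervals.

   A type is a property of a whole connected component, which may leave the
   ellipsoid.  Off the discriminant set the roots are simple, so nearby points
   have nearby roots, matched bijectively and compatibly with conjugation; as
   lambda itself remains a root, the numbers of roots below and above lambda are
   locally constant on Q_lambda, hence constant on components. *)
Require Import Defs.
From HB Require Import structures.
From mathcomp Require Import all_boot all_order all_algebra.
From mathcomp Require Import complex.
From mathcomp Require Import all_classical all_reals all_analysis.
From mathcomp Require Import zify.
Import Order.TTheory GRing.Theory Num.Theory.
Import numFieldNormedType.Exports.
Local Open Scope classical_set_scope.
Local Open Scope ring_scope.

(** * Real roots of a polynomial with weakly alternating signs *)

(* Induction on n, dividing by one root per step: a root in [e 0, e 1[ if
   p.[e 1] != 0, and otherwise e 1 itself, which is then dropped from the list
   of sample points. *)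
Lemma weak_alternation_roots (R : rcfType) (n : nat) (p : {poly R})
    (e : nat -> R) :
  size p = n.+1 ->
  (forall j, (j < n)%N -> e j < e j.+1) ->
  (forall j, (j <= n)%N -> 0 <= (-1) ^+ j * p.[e j]) ->
  exists s : seq R, [/\ size s = n,
    p = lead_coef p *: \prod_(r <- s) ('X - r%:P) &
    forall j, (j < n)%N -> e j <= s`_j <= e j.+1].
Proof.
elim: n p e => [|n IHn] p e sz_p lt_e alt_p.
  exists [::]; split=> //; rewrite big_nil alg_polyC.
  by rewrite {1}(size1_polyC (eq_leq sz_p)) lead_coefE sz_p.
(* The induction hypothesis is applied to [- q]: removing a root shifts the alternation by one
   place, hence the sign flip. *)
have step r f : root p r -> (forall j, (j < n)%N -> f j < f j.+1) ->
    (forall q, p = q * ('X - r%:P) ->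
       forall j, (j <= n)%N -> (-1) ^+ j * q.[f j] <= 0) ->
    exists s : seq R, [/\ size s = n,
      p = lead_coef p *: \prod_(t <- r :: s) ('X - t%:P) &
      forall j, (j < n)%N -> f j <= s`_j <= f j.+1].
  move=> /factor_theorem[q def_p] lt_f alt_q.
  have nz_q : q != 0.
    by apply: contra_eq_neq sz_p => q0; rewrite def_p q0 mul0r size_poly0.
  have [||j lejn|s [sz_s def_q s_in]] := IHn (- q) f => //.
  - move: sz_p; rewrite def_p size_Mmonic ?monicXsubC// size_XsubC addn2.
    by rewrite size_polyN => -[].
  - by rewrite hornerN mulrN oppr_ge0; apply: alt_q.
  exists s; split=> //.
  rewrite def_p lead_coef_Mmonic ?monicXsubC// big_cons mulrC scalerAr; congr (_ * _).
  by apply: oppr_inj; rewrite {1}def_q lead_coefN scaleNr.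
have lt_e0 j : (0 < j <= n.+1)%N -> e 0%N < e j.
  elim: j => [|[|j]] // IHj /andP[_ lej]; first exact: lt_e.
  by rewrite (lt_trans (IHj _)) ?lt_e// (ltnW lej).
have lt_e1 j : (1 < j <= n.+1)%N -> e 1%N < e j.
  elim: j => [|[|[|j]]] // IHj /andP[_ lej]; first exact: lt_e.
  by rewrite (lt_trans (IHj _)) ?lt_e// (ltnW lej).
have tail_sign r q j : p = q * ('X - r%:P) -> r < e j ->
    (j <= n.+1)%N -> 0 <= (-1) ^+ j * q.[e j].
  move=> def_p ltr lej; have := alt_p j lej.
  by rewrite def_p hornerM hornerXsubC mulrA pmulr_lge0 // subr_gt0.
have [p1|nz_p1] := eqVneq p.[e 1%N] 0; last first.
  have [r /andP[le_r ge_r] root_r]: exists2 r, e 0%N <= r <= e 1%N & root p r.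
    have [|r r_in] := @poly_ivt _ (- p) _ _ (ltW (lt_e 0%N isT)).
      rewrite !hornerN oppr_le0 oppr_ge0.
      have := alt_p 0%N isT; have := alt_p 1%N isT.
      by rewrite expr0 mul1r expr1 mulN1r oppr_ge0 => -> ->.
    by rewrite rootN; exists r.
  (* Strictness puts all the sample points from [e 1] on to the right of [r], so that the factor
     ['X - r%:P] is positive there. *)
  have lt_r : r < e 1%N.
    by rewrite lt_neqAle ge_r andbT; apply: contraNneq nz_p1 => <-.
  have [//|j ltj|q def_p j lej|s [sz_s def_p s_in]] := step r (fun j => e j.+1).
  - exact: lt_e.
  - have := tail_sign r q j.+1 def_p.
    rewrite exprS mulN1r mulNr oppr_ge0; apply => //.
    by case: j lej => [|j] lej //; apply: lt_trans lt_r (lt_e1 _ _).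
  exists (r :: s); split=> //=; first by rewrite sz_s.
  by case=> [|j] ltj /=; [rewrite le_r ge_r | apply: s_in].
have root1 : root p (e 1%N) by apply/eqP.
(* Without [e 1], only [e 0] lies to the left of the root; its factor is negative there, which
   supplies the sign flip that the other points get from their shifted index. *)
pose f j := if j is 0%N then e 0%N else e j.+1.
have [//|[|j] ltj|q def_p [|j] lej|s [sz_s def_p s_in]] := step (e 1%N) f.
- exact: lt_e0.
- exact: lt_e.
- have := alt_p 0%N isT; rewrite def_p hornerM hornerXsubC /= !expr0 !mul1r.
  by rewrite nmulr_lge0 // subr_lt0 lt_e.
- have := tail_sign _ q j.+2 def_p.
  rewrite exprS mulN1r mulNr oppr_ge0; apply => //; exact: lt_e1.
case: s sz_s def_p s_in => [|r s] sz_s def_p s_in.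
  exists [:: e 1%N]; split; rewrite //= -?sz_s// => -[|j] //= _.
  by rewrite lexx ltW ?lt_e.
have n_gt0 : (0 < n)%N by rewrite -sz_s.
have /andP[/= le_r ge_r] := s_in 0%N n_gt0.
have s_inS j : (j.+2 < n.+1)%N -> e j.+2 <= s`_j <= e j.+3 by apply: (s_in j.+1).
(* The first remaining root [r] is only known to lie between [e 0] and [e 2]; its position relative
   to [e 1] decides which of [r] and [e 1] is listed first. *)
have [le_r1|lt_1r] := leP r (e 1%N).
  exists [:: r, e 1%N & s]; split; rewrite //= -?sz_s//.
    by rewrite {1}def_p !big_cons mulrCA.
  case=> [|[|j]] ltj /=; first by rewrite le_r le_r1.
    by rewrite lexx ltW ?lt_e.
  by apply: s_inS; rewrite -sz_s.
exists [:: e 1%N, r & s]; split; rewrite //= -?sz_s//.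
case=> [|[|j]] ltj /=; first by rewrite lexx ltW ?lt_e.
  by rewrite ge_r ltW.
by apply: s_inS; rewrite -sz_s.
Qed.

(** * Stability of root counts under small perturbations *)

Lemma norm_away_from0 (C : numFieldType) (s : seq C) :
  exists2 e : C, 0 < e & {in s, forall z, z != 0 -> e <= `|z|}.
Proof.
(* The sum dominates each inverse modulus; a zero element contributes [0^-1 = 0], and the 1 keeps
   [S] positive in every case. *)
pose S := 1 + \sum_(z <- s) `|z|^-1.
have S_gt0 : 0 < S.
  by rewrite (lt_le_trans ltr01)// lerDl sumr_ge0// => z _; rewrite invr_ge0.
exists S^-1 => [|z sz nz]; first by rewrite invr_gt0.
rewrite -[leRHS]invrK lef_pV2 ?posrE ?invr_gt0 ?normr_gt0//.
by rewrite /S (big_rem z)//= addrCA lerDl addr_ge0// sumr_ge0.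
Qed.

(** The doubled bound makes the open disks of radius [e] around distinct elements disjoint. *)
Lemma root_separation (C : numFieldType) (s : seq C) :
  exists2 e : C, 0 < e & {in s &, forall z t, z != t -> e *+ 2 <= `|z - t|}.
Proof.
have [e e_gt0 sep] := norm_away_from0 C [seq z - t | z <- s, t <- s].
exists (e / 2); first by rewrite divr_gt0.
move=> z t sz st neq; rewrite mulr2n -splitr.
by apply: sep; rewrite ?subr_eq0//; apply/allpairsP; exists (z, t).
Qed.

(* A map sending each z to the w close to it is a bijection Z -> W, by
   injectivity and cardinality.  It commutes with conjugation, so it preserves
   both being real and not being real; and it fixes x. *)
Lemma close_roots_count (C : numClosedFieldType) (Z W : seq C) (e x : C) :
  x \is Num.real -> uniq Z -> size W = size Z ->
  {in Z, forall z, z^* \in Z} -> {in W, forall w, w^* \in W} ->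
  x \in Z -> x \in W ->
  {in Z &, forall z t, z != t -> e *+ 2 <= `|z - t|} ->
  {in Z, forall z, exists2 w, w \in W & `|z - w| < e} ->
  count (fun z => z < x) W = count (fun z => z < x) Z /\
  count (fun z => x < z) W = count (fun z => x < z) Z.
Proof.
move=> xR uZ szW ZJ WJ Zx Wx sep near.
pose f z := nth 0 W (find (fun w => `|z - w| < e) W).
have hasf z : z \in Z -> has (fun w => `|z - w| < e) W.
  by move=> /near[w Ww zw]; apply/hasP; exists w.
have fW z : z \in Z -> f z \in W by move=> /hasf; rewrite has_find; apply: mem_nth.
have fe z : z \in Z -> `|z - f z| < e by move=> /hasf /(nth_find 0).
have close z t w : z \in Z -> t \in Z -> `|z - w| < e -> `|t - w| < e -> z = t.
  move=> Zz Zt zw tw; apply/eqP; apply: contraT => /(sep _ _ Zz Zt).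
  suff /lt_geF-> : `|z - t| < e *+ 2 by [].
  have -> : z - t = (z - w) - (t - w) by rewrite opprB addrA subrK.
  by rewrite (le_lt_trans (ler_normB _ _)) // mulr2n ltrD.
have injf : {in Z &, injective f}.
  move=> z t Zz Zt eqf; apply: (close z t (f z)); rewrite ?fe//.
  by rewrite eqf fe.
have uf : uniq (map f Z) by rewrite map_inj_in_uniq.
have subf : {subset map f Z <= W} by move=> _ /mapP[z Zz ->]; apply: fW.
have [_ eqfW] := uniq_min_size uf subf (eq_leq (etrans szW (esym (size_map f Z)))).
have uW : uniq W by rewrite -(eq_uniq _ eqfW)// size_map szW.
have permf : perm_eq W (map f Z) by rewrite uniq_perm // => z; rewrite eqfW.
have surjf w : w \in W -> exists2 z, z \in Z & w = f z.
  by rewrite -eqfW => /mapP.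
have fJ z : z \in Z -> f z^* = (f z)^*.
  move=> Zz; have [t Zt eqt] := surjf _ (WJ _ (fW _ Zz)).
  rewrite eqt; congr f; apply: (close _ _ (f z)^*); rewrite ?ZJ//.
    by rewrite -rmorphB norm_conjC fe.
  by rewrite eqt fe.
have fx : f x = x.
  have [t Zt eqt] := surjf _ Wx.
  suff {1}-> : x = t by [].
  apply: (close _ _ x) => //; last by rewrite {1}eqt fe.
  by rewrite subrr normr0 (le_lt_trans _ (fe _ Zx)).
have fR z : z \in Z -> (f z \is Num.real) = (z \is Num.real).
  move=> Zz; rewrite !CrealE -fJ//.
  by apply/eqP/eqP => [/injf->//|->//]; rewrite ZJ.
have nonreal_lt w : w \isn't Num.real -> ((w < x) = false) * ((x < w) = false).
  move=> wR; split; apply/negP => /ltW/ler_real eqR; move: wR.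
    by rewrite eqR xR.
  by rewrite -eqR xR.
have ltf z : z \in Z -> ((f z < x) = (z < x)) * ((x < f z) = (x < z)).
  move=> Zz; case: (boolP (z \is Num.real)) => zR; last first.
    by rewrite !nonreal_lt ?fR.
  have fzR : f z \is Num.real by rewrite fR.
  have [->|neq] := eqVneq z x; first by rewrite fx.
  have far := sep _ _ Zz Zx neq; have cl := fe z Zz.
  have e_ge0 : 0 <= e by rewrite (le_trans _ (ltW cl)).
  have eR := ger0_real e_ge0.
  (* Since [z] is farther than [e] from [x] while [f z] is within [e] of [z], both lie on the same
     side of [x]. *)
  have farr : e < `|z - x|.
    apply: lt_le_trans far; rewrite mulr2n ltrDl.
    exact: le_lt_trans cl.
  have [lt_zx|lt_xz|eq_zx] := real_ltgtP zR xR; last by rewrite eq_zx eqxx in neq.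
    have lt_f : f z < x.
      move: farr; rewrite ltr0_norm ?subr_lt0// opprB => farr.
      move: cl; rewrite distrC real_ltr_norml ?rpredB// => /andP[_ ].
      rewrite ltrBlDr => /lt_trans; apply.
      by rewrite -ltrBrDr.
    by rewrite lt_f (lt_gtF lt_f).
  have lt_f : x < f z.
    move: farr; rewrite gtr0_norm ?subr_gt0// => farr.
    move: cl; rewrite real_ltr_norml ?rpredB// => /andP[_ cl].
    by have := lt_trans cl farr; rewrite ltrD2l ltrN2.
  by rewrite lt_f (lt_gtF lt_f).
split; rewrite (permP permf) count_map; apply: eq_in_count => z Zz /=;
  by rewrite ltf.
Qed.

(** * The confocal polynomial and its roots *)

Lemma signature_sqr (R : realType) (k l : nat) (i : 'I_(k + l)) :
  signature R i * signature R i = 1.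
Proof. by rewrite /signature; case: ifP; rewrite ?mulrNN mulr1. Qed.

Lemma confocal_factor (R : realType) (k l : nat) (a : 'I_(k + l) -> R)
    (i : 'I_(k + l)) (lam : R) :
  a i - signature R i * lam = signature R i * (pole a i - lam).
Proof. by rewrite mulrBr /pole mulrA signature_sqr mul1r. Qed.

Lemma signature_neq0 (R : realType) (k l : nat) (i : 'I_(k + l)) :
  signature R i != 0.
Proof. by rewrite /signature; case: ifP; rewrite ?oppr_eq0 oner_eq0. Qed.

Lemma pole_inj (R : realType) (k l : nat) (a : 'I_(k + l) -> R) :
  admissible a -> injective (pole a).
Proof.
move=> [_ lt_pole] i j eqij; apply: val_inj => /=.
by case: (ltngtP i j) => // /lt_pole; rewrite eqij ltxx.
Qed.

Lemma horner_confocal_poly (R : realType) (k l : nat) (a : 'I_(k + l) -> R)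
    (x : 'rV[R]_(k + l)) (lam : R) :
  (confocal_poly a x).[lam] =
    \sum_i x ord0 i ^+ 2 * \prod_(j | j != i) (a j - signature R j * lam)
    - \prod_j (a j - signature R j * lam).
Proof.
have hp (A : pred 'I_(k + l)) :
    (\prod_(j | A j) ((a j)%:P - signature R j *: 'X)).[lam] =
      \prod_(j | A j) (a j - signature R j * lam).
  by rewrite horner_prod; apply: eq_bigr => j _; rewrite !hornerE.
rewrite hornerD hornerN hp horner_sum; congr (_ - _).
by apply: eq_bigr => i _; rewrite hornerZ hp.
Qed.

(** Every product that contains the factor of index [i] vanishes at this pole, and only the [i]-th
    summand omits that factor. *)
Lemma horner_confocal_poly_pole (R : realType) (k l : nat)
    (a : 'I_(k + l) -> R) (x : 'rV[R]_(k + l)) (i : 'I_(k + l)) :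
  (confocal_poly a x).[pole a i] =
    x ord0 i ^+ 2 * \prod_(j | j != i) (a j - signature R j * pole a i).
Proof.
have zero : a i - signature R i * pole a i = 0.
  by rewrite confocal_factor subrr mulr0.
rewrite horner_confocal_poly (bigD1 i)//= [X in _ + X - _]big1 => [|j neq_ji].
  by rewrite addr0 [X in _ - X](bigD1 i)//= zero mul0r subr0.
by rewrite (bigD1 i) 1?eq_sym//= zero mul0r mulr0.
Qed.

(** At a pole the surviving product is nonzero because the poles are distinct, which leaves the
    equation of the coordinate hyperplane. Elsewhere no denominator vanishes, and clearing them is
    reversible. *)
Lemma confocalE (R : realType) (k l : nat) (a : 'I_(k + l) -> R)
    (x : 'rV[R]_(k + l)) (lam : R) :
  admissible a -> confocal a lam x <-> root (confocal_poly a x) lam.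
Proof.
move=> ha; rewrite /confocal /root /=; case: pickP => [i /eqP->|not_pole].
  have nz : \prod_(j | j != i) (a j - signature R j * pole a i) != 0.
    apply/prodf_neq0 => j neq_ji.
    rewrite confocal_factor mulf_neq0 ?signature_neq0// subr_eq0.
    by apply: contraNneq neq_ji => /(pole_inj _ _ _ _ ha) ->.
  rewrite horner_confocal_poly_pole mulf_eq0 (negPf nz) orbF sqrf_eq0.
  by split=> /eqP.
have nz i : a i - signature R i * lam != 0.
  by rewrite confocal_factor mulf_neq0 ?signature_neq0// subr_eq0 eq_sym not_pole.
have -> : (confocal_poly a x).[lam] =
    (\prod_j (a j - signature R j * lam)) *
      (\sum_i x ord0 i ^+ 2 / (a i - signature R i * lam) - 1).
  rewrite horner_confocal_poly mulrBr mulr1; congr (_ - _).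
  rewrite mulr_sumr; apply: eq_bigr => i _.
  by rewrite [X in _ = X * _](bigD1 i)//= [RHS]mulrC -[RHS]mulrA mulKf.
rewrite mulf_eq0 (negPf (introT (prodf_neq0 _ _ ) _)) ?subr_eq0//=.
by split=> /eqP.
Qed.

Lemma confocal_poly_factors (R : realType) (k l : nat) (a : 'I_(k + l) -> R)
    (A : pred 'I_(k + l)) :
  \prod_(j | A j) ((a j)%:P - signature R j *: 'X) =
    (\prod_(j | A j) - signature R j) *: \prod_(j | A j) ('X - (pole a j)%:P).
Proof.
rewrite -scaler_prod; apply: eq_bigr => j _.
rewrite scaleNr scalerBr opprB -mul_polyC -mul_polyC -polyCM.
by rewrite /pole mulrA signature_sqr mul1r.
Qed.

(** The sum has degree less than d, so the top term comes from the full product alone and does not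
    depend on the point. *)
Lemma size_lead_confocal_poly (R : realType) (k l : nat) (a : 'I_(k + l) -> R)
    (x : 'rV[R]_(k + l)) :
  size (confocal_poly a x) = (k + l).+1 /\
  lead_coef (confocal_poly a x) = - \prod_j (- signature R (j : 'I_(k + l))).
Proof.
set c := \prod_j _.
have c_neq0 : c != 0.
  by apply/prodf_neq0 => j _; rewrite oppr_eq0 signature_neq0.
have sz_full : size (\prod_j ('X - (pole a j)%:P)) = (k + l).+1.
  by rewrite size_prod_XsubC /index_enum -enumT size_enum_ord.
have sz_part i : size (\prod_(j | j != i) ('X - (pole a j)%:P)) = (k + l)%N.
  move: sz_full; rewrite (bigD1 i)//= size_Mmonic ?monic_prod_XsubC//.
    by rewrite size_XsubC add2n => -[].
  by rewrite polyXsubC_eq0.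
have sz_sum : (size (\sum_i x ord0 i ^+ 2 *:
      \prod_(j | j != i) ((a j)%:P - signature R j *: 'X))%R <= k + l)%N.
  apply: leq_trans (size_sum _ _ _) _; apply/bigmax_leqP => i _.
  rewrite confocal_poly_factors.
  by rewrite !(leq_trans (size_scale_leq _ _)) ?sz_part.
have szN : size (- (c *: \prod_j ('X - (pole a j)%:P))) = (k + l).+1.
  by rewrite size_polyN size_scale.
rewrite /confocal_poly [X in _ - X]confocal_poly_factors -/c.
rewrite addrC size_polyDl ?lead_coefDl ?szN ?ltnS//; split=> //.
by rewrite lead_coefN lead_coefZ (eqP (monic_prod_XsubC _ _ _)) mulr1.
Qed.

(** Consequently the modulus of the polynomial at [z] is exactly the product of the distances from
    [z] to its roots. *)
Lemma norm_lead_confocal_poly (R : realType) (k l : nat)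
    (a : 'I_(k + l) -> R) (x : 'rV[R]_(k + l)) :
  `|lead_coef (confocal_poly a x)| = 1.
Proof.
have [_ ->] := size_lead_confocal_poly R k l a x.
rewrite normrN normr_prod big1// => j _; rewrite normrN /signature.
by case: ifP => _; rewrite ?normrN normr1.
Qed.

Lemma gen_jacobiE (R : realType) (k l : nat) (a : 'I_(k + l) -> R)
    (x : 'rV[R]_(k + l)) :
  map_poly (real_complex R) (confocal_poly a x) =
    real_complex R (lead_coef (confocal_poly a x)) *:
      \prod_(z <- gen_jacobi a x) ('X - z%:P).
Proof.
rewrite -lead_coef_map; exact: svalP (closed_field_poly_normal _).
Qed.

Lemma lead_confocal_poly_neq0 (R : realType) (k l : nat)
    (a : 'I_(k + l) -> R) (x : 'rV[R]_(k + l)) :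
  lead_coef (confocal_poly a x) != 0.
Proof. by rewrite -normr_gt0 norm_lead_confocal_poly. Qed.

Lemma size_gen_jacobi (R : realType) (k l : nat) (a : 'I_(k + l) -> R)
    (x : 'rV[R]_(k + l)) : size (gen_jacobi a x) = (k + l)%N.
Proof.
apply: succn_inj; have [<- _] := size_lead_confocal_poly R k l a x.
rewrite -(size_map_poly (real_complex R)) gen_jacobiE size_scale ?size_prod_XsubC//.
by rewrite fmorph_eq0 lead_confocal_poly_neq0.
Qed.

Lemma mem_gen_jacobi (R : realType) (k l : nat) (a : 'I_(k + l) -> R)
    (x : 'rV[R]_(k + l)) (z : R[i]) :
  (z \in gen_jacobi a x) =
    root (map_poly (real_complex R) (confocal_poly a x)) z.
Proof.
rewrite gen_jacobiE rootZ ?root_prod_XsubC//.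
by rewrite fmorph_eq0 lead_confocal_poly_neq0.
Qed.

Lemma mem_gen_jacobi_real (R : realType) (k l : nat) (a : 'I_(k + l) -> R)
    (x : 'rV[R]_(k + l)) (lam : R) :
  admissible a ->
  confocal a lam x <-> real_complex R lam \in gen_jacobi a x.
Proof. by move=> ha; rewrite confocalE// mem_gen_jacobi fmorph_root. Qed.

Lemma gen_jacobi_conj (R : realType) (k l : nat) (a : 'I_(k + l) -> R)
    (x : 'rV[R]_(k + l)) (z : R[i]) :
  z \in gen_jacobi a x -> (z^*)%R \in gen_jacobi a x.
Proof.
rewrite !mem_gen_jacobi /root => /eqP root_z; rewrite -conjC0 -root_z.
rewrite -horner_map -map_poly_comp; apply/eqP; congr (_.[_]).
by apply: eq_map_poly => t /=; apply/esym/CrealP/complex_realP; exists t.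
Qed.

Lemma gen_jacobi_perm (R : realType) (k l : nat) (a : 'I_(k + l) -> R)
    (x : 'rV[R]_(k + l)) (s : seq R) :
  confocal_poly a x =
    lead_coef (confocal_poly a x) *: \prod_(r <- s) ('X - r%:P) ->
  perm_eq (gen_jacobi a x) (map (real_complex R) s).
Proof.
move=> def_p; apply: prod_XsubC_eq; rewrite big_map.
have nz : real_complex R (lead_coef (confocal_poly a x)) != 0.
  by rewrite fmorph_eq0 lead_confocal_poly_neq0.
apply: (can_inj (scalerK nz)); rewrite -gen_jacobiE {1}def_p.
by rewrite map_polyZ map_prod_XsubC.
Qed.

(** * Signs at the endpoints and interlacing of the Jacobi coordinates *)

(** [N] marks the negative factors among those selected by [A]. *)
Lemma prod_sign (R : realDomainType) (I : finType) (A N : pred I) (f : I -> R) :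
  (forall i, A i -> 0 < (-1) ^+ N i * f i) -> (forall i, N i -> A i) ->
  0 < (-1) ^+ #|N| * \prod_(i | A i) f i.
Proof.
move=> f_sign NA.
have -> : (-1) ^+ #|N| = \prod_(i | A i) (-1) ^+ N i :> R.
  rewrite -prodr_const [LHS]big_mkcond [RHS]big_mkcond /=; apply: eq_bigr => i _.
  rewrite -topredE /=; case NAi: (N i); first by rewrite NA.
  by case: ifP.
by rewrite -big_split /= prodr_gt0.
Qed.

Lemma card_ord_itv (n p q : nat) :
  (q <= n)%N -> #|[pred j : 'I_n | (p <= j < q)%N]| = (q - p)%N.
Proof.
move=> leqn; rewrite -sum1_card -[RHS]muln1 -sum_nat_const_nat.
rewrite (big_nat_widen _ _ _ _ _ leqn) big_geq_mkord /=.
by apply: eq_bigl => j; rewrite !inE andbC.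
Qed.

Lemma pole_lt (R : realType) (k l : nat) (a : 'I_(k + l) -> R)
    (i j : 'I_(k + l)) :
  admissible a -> (pole a j < pole a i) = (i < j)%N.
Proof.
move=> [_ lt_pole]; case: (ltngtP i j) => [/lt_pole//|/lt_pole/lt_gtF//|].
by move=> /val_inj->; rewrite ltxx.
Qed.

Lemma pole_gt0 (R : realType) (k l : nat) (a : 'I_(k + l) -> R)
    (i : 'I_(k + l)) :
  admissible a -> (0 < pole a i) = (i < k)%N.
Proof.
move=> [a_gt0 _]; rewrite /pole /signature; case: ifP => _; first by rewrite mul1r a_gt0.
by rewrite mulN1r oppr_gt0; exact: lt_gtF (a_gt0 i).
Qed.

Lemma pole_lt0 (R : realType) (k l : nat) (a : 'I_(k + l) -> R)
    (i : 'I_(k + l)) :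
  admissible a -> (pole a i < 0) = (k <= i)%N.
Proof.
move=> [a_gt0 _]; rewrite /pole /signature [RHS]leqNgt; case: ifP => _ /=.
  by rewrite mul1r; exact: lt_gtF (a_gt0 i).
by rewrite mulN1r oppr_lt0 a_gt0.
Qed.

(** The exponent counts the poles strictly between 0 and [pole a i]. These give exactly the negative
    factors of the surviving product: indices of the other signature always contribute positive
    ones. *)
Lemma confocal_poly_pole_sign (R : realType) (k l : nat)
    (a : 'I_(k + l) -> R) (x : 'rV[R]_(k + l)) (i : 'I_(k + l)) :
  admissible a ->
  0 <= (-1) ^+ (if (i < k)%N then k - i.+1 else i - k)%N *
       (confocal_poly a x).[pole a i].
Proof.
move=> ha; rewrite horner_confocal_poly_pole mulrCA mulr_ge0 ?sqr_ge0//.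
pose N := [pred j : 'I_(k + l) | if (i < k)%N then (i < j < k)%N else (k <= j < i)%N].
have -> : (if (i < k)%N then k - i.+1 else i - k)%N = #|N|.
  by rewrite /N; case: ifP => _; rewrite card_ord_itv ?leq_addr// ltnW.
apply/ltW/prod_sign => [j neq_ji|j]; last first.
  by rewrite /N inE; apply: contraTneq => ->; case: ifP => _; rewrite ltnn // andbF.
have neq_ji' : (j : nat) != i by [].
rewrite confocal_factor /signature /N /=.
have := pole_lt _ _ _ _ j i ha; have := pole_lt _ _ _ _ i j ha.
case: (ltnP i k) => ik; case: (ltnP j k) => jk; rewrite ?andbT ?andbF/= ?mul1r ?mulN1r.
- case: (ltngtP i j) neq_ji' => //= ij _; rewrite ?expr0 ?expr1 ?mul1r ?mulN1r => h1 h2;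
  by rewrite ?oppr_gt0 ?subr_gt0 ?subr_lt0 ?h1 ?h2.
- rewrite ?expr0 ?mul1r oppr_gt0 subr_lt0 => -> _; exact: leq_trans ik jk.
- rewrite ?expr0 ?mul1r subr_gt0 => _ ->; exact: leq_trans jk ik.
case: (ltngtP j i) neq_ji' => //= ij _; rewrite ?expr0 ?expr1 ?mul1r ?mulN1r => h1 h2;
by rewrite ?opprK ?oppr_gt0 ?subr_gt0 ?subr_lt0 ?h1 ?h2.
Qed.

Lemma confocal_poly0_lt0 (R : realType) (k l : nat) (a : 'I_(k + l) -> R)
    (x : 'rV[R]_(k + l)) :
  admissible a -> inside_ellipsoid a x -> (confocal_poly a x).[0] < 0.
Proof.
move=> [a_gt0 _] inx.
have -> : (confocal_poly a x).[0] =
    (\prod_j a j) * (\sum_i x ord0 i ^+ 2 / a i - 1).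
  rewrite horner_confocal_poly mulrBr mulr1 mulr_sumr.
  have e (A : pred 'I_(k + l)) :
      \prod_(j | A j) (a j - signature R j * 0) = \prod_(j | A j) a j.
    by apply: eq_bigr => j _; rewrite mulr0 subr0.
  rewrite e; congr (_ - _); apply: eq_bigr => i _.
  by rewrite e [in RHS](bigD1 i)//= [RHS]mulrC -[RHS]mulrA mulKf ?gt_eqF.
by rewrite pmulr_rlt0 ?prodr_gt0// subr_lt0.
Qed.

Lemma endpointE (R : realType) (k l : nat) (a : 'I_(k + l) -> R) (n : nat) :
  (n <= k + l)%N ->
  endpoint a n =
    nth 0 ([seq a (lshift l i) | i <- enum 'I_k] ++
           0 :: [seq - a (rshift k j) | j <- enum 'I_l]) (k + l - n).
Proof.
move=> len; rewrite /endpoint /endpoints.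
have sz (A B : seq R) : size A = k -> size B = l -> size (A ++ 0 :: B) = (k + l).+1.
  by move=> szA szB; rewrite size_cat /= szA szB addnS.
have szE := sz _ _ (etrans (size_map _ _) (size_enum_ord k))
  (etrans (size_map _ _) (size_enum_ord l)).
by rewrite nth_rev szE.
Qed.

Lemma endpoint_zero (R : realType) (k l : nat) (a : 'I_(k + l) -> R) :
  endpoint a l = 0.
Proof.
rewrite endpointE ?leq_addl// addnK nth_cat size_map size_enum_ord ltnn.
by rewrite subnn.
Qed.

(** The endpoints increase while the poles decrease with their index, and the inserted 0, at place
    l, pushes the positive poles one place further. *)
Lemma endpoint_pole (R : realType) (k l : nat) (a : 'I_(k + l) -> R)
    (i : 'I_(k + l)) :
  endpoint a (if (i < k)%N then k + l - i else k + l - i.+1)%N = pole a i.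
Proof.
have lti := ltn_ord i.
rewrite endpointE; last by case: ifP => _; rewrite leq_subr.
rewrite nth_cat size_map size_enum_ord /pole /signature.
have lei := ltnW lti.
case: (ltnP i k) => [ltik|leki]; rewrite subKn//.
  rewrite ltik mul1r (nth_map (Ordinal ltik)) ?size_enum_ord//.
  by congr (a _); apply: val_inj; rewrite /= nth_enum_ord.
rewrite ltnNge (leqW leki) /= subSn//= mulN1r.
have lt_il : (i - k < l)%N by rewrite ltn_subLR.
rewrite (nth_map (Ordinal lt_il)) ?size_enum_ord//.
by congr (- a _); apply: val_inj; rewrite /= nth_enum_ord// subnKC.
Qed.

Lemma endpointP (R : realType) (k l : nat) (a : 'I_(k + l) -> R) (n : nat) :
  (n <= k + l)%N ->
  n = l \/ exists2 i : 'I_(k + l),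
    n = (if (i < k)%N then k + l - i else k + l - i.+1)%N &
    endpoint a n = pole a i.
Proof.
move=> len; case: (ltngtP n l) => hn; [right|right|by left].
  have lti : (k + l - n.+1 < k + l)%N by lia.
  have en : n = (if (Ordinal lti < k)%N then k + l - Ordinal lti
                 else k + l - (Ordinal lti).+1)%N.
    by move=> /=; case: ifP => h; lia.
  by exists (Ordinal lti) => //; rewrite {1}en endpoint_pole.
have lti : (k + l - n < k + l)%N by lia.
have en : n = (if (Ordinal lti < k)%N then k + l - Ordinal lti
               else k + l - (Ordinal lti).+1)%N.
  by move=> /=; case: ifP => h; lia.
by exists (Ordinal lti) => //; rewrite {1}en endpoint_pole.
Qed.

Lemma endpoint_lt (R : realType) (k l : nat) (a : 'I_(k + l) -> R) (n : nat) :
  admissible a -> (n < k + l)%N -> endpoint a n < endpoint a n.+1.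
Proof.
move=> ha ltn.
have [en|[i en ->]] := endpointP _ _ _ a n (ltnW ltn);
  have [en1|[j en1 ->]] := endpointP _ _ _ a n.+1 ltn.
- lia.
- rewrite en endpoint_zero pole_gt0//; move: en1; have := ltn_ord j; case: ifP; lia.
- rewrite en1 endpoint_zero pole_lt0//; move: en; have := ltn_ord i; case: ifP; lia.
- rewrite pole_lt//; move: en en1; have := ltn_ord i; have := ltn_ord j.
  by do 2 case: ifP; lia.
Qed.

(** The factor [(-1) ^+ l.+1] is dictated by 0 being endpoint number l, where the polynomial is
    negative. At a pole it remains to compare the parities of two exponents. *)
Lemma confocal_poly_endpoint_sign (R : realType) (k l : nat)
    (a : 'I_(k + l) -> R) (x : 'rV[R]_(k + l)) (n : nat) :
  admissible a -> inside_ellipsoid a x -> (n <= k + l)%N ->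
  0 <= (-1) ^+ n * ((-1) ^+ l.+1 *: confocal_poly a x).[endpoint a n].
Proof.
move=> ha inx len; rewrite hornerZ mulrA -exprD -signr_odd.
have [->|[i en ->]] := endpointP _ _ _ a n len.
  rewrite endpoint_zero addnS /= oddD addbb /= expr1 mulN1r oppr_ge0 ltW//.
  exact: confocal_poly0_lt0.
have := confocal_poly_pole_sign _ _ _ a x i ha.
rewrite -signr_odd; congr (0 <= (-1) ^+ nat_of_bool _ * _).
by move: en; have := ltn_ord i; case: ifP; lia.
Qed.

Lemma jacobi_interlacing (R : realType) (k l : nat) (a : 'I_(k + l) -> R)
    (x : 'rV[R]_(k + l)) :
  admissible a -> inside_ellipsoid a x ->
  exists s : seq R, [/\ size s = (k + l)%N,
    perm_eq (gen_jacobi a x) (map (real_complex R) s) &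
    forall j, (j < k + l)%N -> endpoint a j <= s`_j <= endpoint a j.+1].
Proof.
move=> ha inx; have nz : (-1) ^+ l.+1 != 0 :> R by rewrite signr_eq0.
have [sz_p _] := size_lead_confocal_poly R k l a x.
have [|j ltj|j lej|s [sz_s def_p s_in]] := weak_alternation_roots R (k + l)%N
  ((-1) ^+ l.+1 *: confocal_poly a x) (endpoint a).
- by rewrite size_scale.
- exact: endpoint_lt.
- exact: confocal_poly_endpoint_sign.
exists s; split=> //; apply: gen_jacobi_perm; apply: (can_inj (scalerK nz)).
by rewrite {1}def_p lead_coefZ scalerA.
Qed.

(** * Local constancy of the numbers of roots below and above the parameter *)

(** If all the distances were at least [e], so would be their product compared with
    [e ^+ size W]. *)
Lemma close_root (F : numFieldType) (W : seq F) (z e : F) :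
  0 <= e -> `|\prod_(w <- W) (z - w)| < e ^+ size W ->
  exists2 w, w \in W & `|z - w| < e.
Proof.
move=> e_ge0 lt_prod; apply/hasP; apply: contraTT lt_prod => /hasPn far.
rewrite real_ltNge ?negbK ?ger0_real ?exprn_ge0 ?normr_ge0//.
elim: W far => [|w W IHW] far; first by rewrite big_nil normr1.
rewrite big_cons normrM exprS ler_pM ?exprn_ge0//.
  have := far w (mem_head _ _).
  by rewrite real_ltNge ?ger0_real ?normr_ge0// negbK.
by apply: IHW => t tW; apply: far; rewrite inE tW orbT.
Qed.

(** The full product does not involve the point and cancels, so the difference is linear in the
    changes of the squared coordinates. *)
Lemma confocal_poly_complexB (R : realType) (k l : nat) (a : 'I_(k + l) -> R)
    (x y : 'rV[R]_(k + l)) (z : R[i]) :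
  (map_poly (real_complex R) (confocal_poly a y)).[z] -
  (map_poly (real_complex R) (confocal_poly a x)).[z] =
  \sum_i real_complex R (y ord0 i ^+ 2 - x ord0 i ^+ 2) *
    (map_poly (real_complex R)
      (\prod_(j | j != i) ((a j)%:P - signature R j *: 'X))).[z].
Proof.
rewrite -hornerN -hornerD -rmorphB /confocal_poly opprB addrA subrK.
rewrite -sumrB rmorph_sum horner_sum; apply: eq_bigr => i _.
by rewrite -scalerBl /= map_polyZ hornerZ.
Qed.

Lemma near_sqr_coord (R : realType) (n : nat) (x : 'rV[R]_n) (e : R) :
  0 < e -> \forall y \near x, forall i : 'I_n,
    `|(y : 'rV[R]_n) ord0 i ^+ 2 - x ord0 i ^+ 2| < e.
Proof.
move=> e_gt0; refine (@filter_forall _ _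
  (fun (i : 'I_n) (y : 'rV[R]_n) => `|y ord0 i ^+ 2 - x ord0 i ^+ 2| < e)
  (nbhs x) _ _) => i.
have sqr_cvg : (fun y : 'rV[R]_n => y ord0 i ^+ 2) @ x --> x ord0 i ^+ 2.
  have cx := @coord_continuous R 1 n ord0 i x.
  exact: (cvgM cx cx).
have /cvgrPdist_lt/(_ e e_gt0) := sqr_cvg.
by apply: filterS => y; rewrite distrC.
Qed.

(** At a root [z] for [x], the polynomial of a nearby [y] has modulus below [e ^+ (k + l)], which
    forces one of its roots to be within [e] of [z]; then [close_roots_count] applies. *)
Lemma near_counts (R : realType) (k l : nat) (a : 'I_(k + l) -> R) (lam : R)
    (x : 'rV[R]_(k + l)) :
  admissible a -> (confocal a lam `\` discriminant_set a) x ->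
  \forall y \near x, (confocal a lam `\` discriminant_set a) y ->
    count (fun z => z < real_complex R lam) (gen_jacobi a y) =
      count (fun z => z < real_complex R lam) (gen_jacobi a x) /\
    count (fun z => real_complex R lam < z) (gen_jacobi a y) =
      count (fun z => real_complex R lam < z) (gen_jacobi a x).
Proof.
move=> ha [lam_x /negP/negPn ux].
have [e e_gt0 sep] := root_separation R[i] (gen_jacobi a x).
pose c (i : 'I_(k + l)) (z : R[i]) := (map_poly (real_complex R)
  (\prod_(j | j != i) ((a j)%:P - signature R j *: 'X))).[z].
(* [K] strictly exceeds the sum of the moduli of the coefficients [c i z] at each root [z], so that
   changes of the squares by less than [del] move the value at [z] by less than
   [del * K = e ^+ (k + l)]. *)
pose K : R[i] := 1 + \sum_(z <- gen_jacobi a x) \sum_i `|c i z|.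
have K_gt0 : 0 < K.
  rewrite (lt_le_trans ltr01)// lerDl.
  by rewrite sumr_ge0// => z _; rewrite sumr_ge0.
pose del : R[i] := e ^+ (k + l) / K.
have del_gt0 : 0 < del by rewrite divr_gt0// exprn_gt0.
(* Being positive, [del] is real; the neighbourhood of [x] requires a bound in [R]. *)
have delE : del = real_complex R (complex.Re del).
  by rewrite [RHS]RRe_real// gtr0_real.
have Re_gt0 : 0 < complex.Re del by rewrite -ltcR -[X in _ < X]delE.
have := near_sqr_coord _ _ x _ Re_gt0; apply: filterS => y close_y [lam_y uy].
apply: (close_roots_count _ _ _ e) => //.
- by apply/complex_realP; exists lam.
- by rewrite !size_gen_jacobi.
- by move=> z; apply: gen_jacobi_conj.
- by move=> z; apply: gen_jacobi_conj.
- exact/mem_gen_jacobi_real.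
- exact/mem_gen_jacobi_real.
move=> z zx; apply: close_root; first exact: ltW.
have -> : `|\prod_(w <- gen_jacobi a y) (z - w)| =
    `|(map_poly (real_complex R) (confocal_poly a y)).[z]|.
  rewrite gen_jacobiE hornerZ normrM horner_prod.
  have -> : `|real_complex R (lead_coef (confocal_poly a y))| = 1.
    rewrite normc_def /= expr0n addr0 sqrtr_sqr.
    by rewrite norm_lead_confocal_poly.
  by rewrite mul1r; congr `|_|; apply: eq_bigr => w _; rewrite hornerXsubC.
have root_x : (map_poly (real_complex R) (confocal_poly a x)).[z] = 0.
  by apply/eqP; rewrite mem_gen_jacobi in zx.
rewrite -[X in `|X|]subr0 -root_x confocal_poly_complexB size_gen_jacobi.
apply: le_lt_trans (ler_norm_sum _ _ _) _.
apply: (@le_lt_trans _ _ (del * \sum_i `|c i z|)).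
  rewrite mulr_sumr; apply: ler_sum => i _; rewrite normrM ler_wpM2r//.
  rewrite delE normc_def /= expr0n addr0 sqrtr_sqr lecR ltW//.
have -> : e ^+ (k + l) = del * K by rewrite /del mulfVK ?gt_eqF.
rewrite ltr_pM2l// /K (big_rem z)//= addrCA ltrDl.
by rewrite (lt_le_trans ltr01)// lerDl sumr_ge0// => t _; rewrite sumr_ge0.
Qed.

(** The level set of [f] through [x] is nonempty, open and closed in the component, hence all of
    it. *)
Lemma component_locally_constant (T : topologicalType) (U : Type) (A : set T)
    (f : T -> U) (x y : T) :
  (forall t, A t -> \forall u \near t, A u -> f u = f t) ->
  connected_component A x y -> f y = f x.
Proof.
move=> f_near Cxy; set C := connected_component A x.
have CA : C `<=` A by apply: connected_component_sub.
have Cx : C x.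
  by apply: connected_component_refl; apply: contrapT => nAx;
     move: Cxy; rewrite connected_component_out.
(* An open set of the ambient space whose trace on the component is the preimage of [V]; taking the
   level and its complement for [V] gives openness and closedness. *)
pose near_set (V : set U) : set T := interior [set u | A u -> V (f u)].
have openN V : open (near_set V) by apply: open_interior.
have inN V t : C t -> near_set V t <-> V (f t).
  move=> Ct; have At := CA _ Ct; split=> [/nbhs_singleton/(_ At)//|Vt].
  by apply: filterS (f_near t At) => u fu Au; rewrite fu.
suff CE : C `&` near_set [set f x] = C.
  have [_ Ny] : (C `&` near_set [set f x]) y by rewrite CE.
  exact: ((inN [set f x] y Cxy).1 Ny).
apply: (@component_connected _ A x).
- by exists x; split => //; apply/inN.
- by exists (near_set [set f x]).
exists (~` near_set (~` [set f x])); first exact: open_closedC.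
apply/seteqP; split=> t [Ct Nt]; split=> //.
  by move=> /(inN _ _ Ct); apply; apply/inN.
by apply/inN => //; apply: contrapT => nft; apply: Nt; apply/inN.
Qed.

(** * Distinct parameters give distinct quadrics *)

Lemma confocal_pole (R : realType) (k l : nat) (a : 'I_(k + l) -> R)
    (i : 'I_(k + l)) (y : 'rV[R]_(k + l)) :
  admissible a -> confocal a (pole a i) y = (y ord0 i = 0).
Proof.
move=> ha; rewrite /confocal /=; case: pickP => [j|/(_ i)]; last by rewrite eqxx.
by move=> /eqP/(pole_inj _ _ _ _ ha) <-.
Qed.

Lemma confocal_nondegenerate (R : realType) (k l : nat)
    (a : 'I_(k + l) -> R) (lam : R) (y : 'rV[R]_(k + l)) :
  ~ degenerate a lam ->
  confocal a lam y =
    (\sum_i y ord0 i ^+ 2 / (a i - signature R i * lam) = 1).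
Proof.
move=> ndeg; rewrite /confocal /=; case: pickP => // i /eqP eq_lam.
by case: ndeg; exists i.
Qed.

(** A basis vector separates two coordinate hyperplanes; the origin separates a hyperplane from a
    nondegenerate quadric. *)
Lemma confocal_pole_neq (R : realType) (k l : nat) (a : 'I_(k + l) -> R)
    (i : 'I_(k + l)) (mu : R) :
  admissible a -> confocal a (pole a i) = confocal a mu -> pole a i = mu.
Proof.
move=> ha eqQ; case: (pselect (degenerate a mu)) => [[j def_mu]|ndeg].
  have [->//|neq_ij] := eqVneq i j.
  have : confocal a (pole a i) (delta_mx ord0 j).
    by rewrite confocal_pole// mxE eqxx (negPf neq_ij).
  rewrite eqQ def_mu confocal_pole// mxE !eqxx => /eqP.
  by rewrite oner_eq0.
have : confocal a (pole a i) 0 by rewrite confocal_pole// mxE.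
rewrite eqQ confocal_nondegenerate// big1 => [/esym/eqP|j _].
  by rewrite oner_eq0.
by rewrite mxE expr0n mul0r.
Qed.

(* A nondegenerate Q_lam meets the i-th axis as soon as a_i - s_i lam > 0; one
   of the indices 0 and k satisfies this, and the intersection determines lam. *)
Lemma confocal_inj (R : realType) (k l : nat) (a : 'I_(k + l) -> R) :
  (0 < k)%N -> (0 < l)%N -> admissible a -> injective (confocal a).
Proof.
move=> hk hl ha lam mu eqQ.
case: (pselect (degenerate a lam)) => [[i def_lam]|ndeg_lam].
  by rewrite def_lam; apply: confocal_pole_neq; rewrite // -def_lam.
case: (pselect (degenerate a mu)) => [[i def_mu]|ndeg_mu].
  by apply/esym; rewrite def_mu; apply: confocal_pole_neq; rewrite // -def_mu.
have [i pos_i] : exists i, 0 < a i - signature R i * lam.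
  have [le0|gt0] := leP lam 0.
    exists (lshift l (Ordinal hk)).
    rewrite /signature /= hk mul1r subr_gt0; apply: le_lt_trans le0 _.
    by case: ha.
  exists (rshift k (Ordinal hl)).
  rewrite /signature /= addn0 ltnn mulN1r opprK addr_gt0//.
  by case: ha.
pose y : 'rV[R]_(k + l) := Num.sqrt (a i - signature R i * lam) *: delta_mx ord0 i.
have sumE nu : \sum_j y ord0 j ^+ 2 / (a j - signature R j * nu) =
    (a i - signature R i * lam) / (a i - signature R i * nu).
  rewrite (bigD1 i)//= big1 => [|j /negPf neq_ji].
    by rewrite !mxE !eqxx mulr1 sqr_sqrtr ?ltW// addr0.
  by rewrite !mxE neq_ji mulr0 expr0n mul0r.
have : confocal a lam y by rewrite confocal_nondegenerate// sumE mulfV ?gt_eqF.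
rewrite eqQ confocal_nondegenerate// sumE => eq1.
have nz : a i - signature R i * mu != 0.
  by apply: contra_eq_neq eq1 => ->; rewrite invr0 mulr0 eq_sym oner_eq0.
have := divr1_eq eq1; move=> /addrI/oppr_inj/mulfI; apply.
exact: signature_neq0.
Qed.

(** * Relativistic types off the discriminant set *)

Lemma EHtype_inj : injective EHtype.
Proof. by case=> [|i] [|j] //= [->]. Qed.

(** The counts are constant on the component of [x], so those at [x] alone decide the type. *)
Lemma type_atE (R : realType) (k l : nat) (a : 'I_(k + l) -> R) (lam : R)
    (x : 'rV[R]_(k + l)) (j : nat) (T : rtype) :
  (1 < k + l)%N -> admissible a -> (j < k + l)%N ->
  (confocal a lam `\` discriminant_set a) x ->
  count (fun z => z < real_complex R lam) (gen_jacobi a x) = j ->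
  count (fun z => real_complex R lam < z) (gen_jacobi a x) = (k + l - j.+1)%N ->
  type_at a lam x T <-> T = EHtype j.
Proof.
move=> d_gt1 ha ltj Ax below_x above_x.
pose f y := (count (fun z => z < real_complex R lam) (gen_jacobi a y),
             count (fun z => real_complex R lam < z) (gen_jacobi a y)).
pose C := connected_component (confocal a lam `\` discriminant_set a) x.
have Cx : C x by apply: connected_component_refl.
have f_const y : C y -> f y = f x.
  apply: component_locally_constant => t At.
  by apply: filterS (near_counts _ _ _ _ _ _ ha At) => u fu /fu[eb ea]; rewrite /f eb ea.
have countsC y : C y ->
    count (fun z => z < real_complex R lam) (gen_jacobi a y) = j /\
    count (fun z => real_complex R lam < z) (gen_jacobi a y) = (k + l - j.+1)%N.
  by move=> /f_const[-> ->].
split=> [[S [[t _ ->] Sx]]|->].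
  case: T => [|i|i] /=.
  - by move=> /(_ x Sx); rewrite above_x => eqj; have -> : j = 0%N by lia.
  - move=> [/andP[i_gt0 _] /(_ x Sx)[]]; rewrite below_x => -> _.
    by case: i i_gt0 => [|i].
  (* The two counts of a [Type0] add up to d - 2, whereas those at [x] add up to d - 1. *)
  by move=> [/= lei /(_ x Sx)[]]; rewrite below_x above_x => eqi; lia.
exists C; split=> //; first by exists x.
case: j ltj {below_x above_x} countsC => [|j] ltj countsC /=.
  by move=> y /countsC[].
split; first lia.
by move=> y /countsC[-> ->]; split=> //; lia.
Qed.

(** Consecutive roots are separated by a common endpoint of their intervals, which gives weak order;
    simplicity of the roots makes it strict. *)
Lemma sorted_jacobi (R : realType) (k l : nat) (a : 'I_(k + l) -> R)
    (x : 'rV[R]_(k + l)) (s : seq R) :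
  size s = (k + l)%N -> perm_eq (gen_jacobi a x) (map (real_complex R) s) ->
  (forall j, (j < k + l)%N -> endpoint a j <= s`_j <= endpoint a j.+1) ->
  ~ discriminant_set a x -> sorted <%O s.
Proof.
move=> sz_s perm_s s_in /negP/negPn uz.
have us : uniq s by rewrite -(map_inj_uniq (@complexI R)) -(perm_uniq perm_s).
rewrite lt_sorted_uniq_le us /=; apply/(sortedP 0) => j ltj.
rewrite sz_s in ltj.
have /andP[_ le1] := s_in j (ltnW ltj); have /andP[le2 _] := s_in j.+1 ltj.
exact: le_trans le1 le2.
Qed.

(** In a strictly increasing list the index of an entry is the number of smaller entries, that is,
    the count that numbers the types. *)
Lemma jacobi_type (R : realType) (k l : nat) (a : 'I_(k + l) -> R)
    (x : 'rV[R]_(k + l)) (s : seq R) (j : nat) (T : rtype) :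
  (1 < k + l)%N -> admissible a ->
  size s = (k + l)%N -> perm_eq (gen_jacobi a x) (map (real_complex R) s) ->
  sorted <%O s -> ~ discriminant_set a x -> (j < k + l)%N ->
  type_at a s`_j x T <-> T = EHtype j.
Proof.
move=> d_gt1 ha sz_s perm_s sorted_s ndisc ltj; have ltjs := ltj; rewrite -sz_s in ltjs.
apply: type_atE => //.
- split=> //; apply/(mem_gen_jacobi_real _ _ _ _ _ _ ha).
  by rewrite (perm_mem perm_s) map_f ?mem_nth.
- rewrite (permP perm_s) count_map -[RHS](count_lt_nth 0 sorted_s ltjs).
  by apply: eq_count => r /=; rewrite ltcR.
rewrite (permP perm_s) count_map -sz_s -(count_le_nth 0 sorted_s ltjs).
rewrite count_le_gt subKn ?count_size//.
by apply: eq_count => r /=; rewrite ltcR.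
Qed.

(** * Quadrics through an interior point, their types and their intervals *)

Theorem proposition4p21 (R : realType) (k l : nat) (hk : (1 <= k)%N)
    (hl : (1 <= l)%N) (a : 'I_(k + l) -> R) (ha : admissible a) :
  (* PE1 *)
  (forall x : 'rV[R]_(k + l), inside_ellipsoid a x ->
     (exists s : (k + l).-tuple R,
        perm_eq (gen_jacobi a x) (map (real_complex R) s) /\
        (forall lam, confocal a lam x <-> lam \in s)) /\
     (~ discriminant_set a x ->
        [/\ ([set Q | range (confocal a) Q /\ Q x] #= `I_(k + l))%card,
            (forall lam, confocal a lam x -> exists! T, type_at a lam x T) &
            (forall lam mu T, confocal a lam x -> confocal a mu x ->
               type_at a lam x T -> type_at a mu x T -> lam = mu)])) /\
  (* PE2 *)
  (forall x : 'rV[R]_(k + l), inside_ellipsoid a x ->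
     ~ discriminant_set a x ->
     [set T | exists2 lam, confocal a lam x & type_at a lam x T]
       = [set EHtype j | j in `I_(k + l)] /\
     forall (j : nat) (lam : R), (j < k + l)%N -> confocal a lam x ->
       (type_at a lam x (EHtype j) ->
          endpoint a j <= lam <= endpoint a j.+1) /\
       (~ degenerate a lam ->
          (type_at a lam x (EHtype j) <->
           endpoint a j < lam < endpoint a j.+1))).
Proof.
have d_gt1 : (1 < k + l)%N by rewrite (leq_add hk hl).
have roots x : inside_ellipsoid a x -> exists s : seq R, [/\ size s = (k + l)%N,
    perm_eq (gen_jacobi a x) (map (real_complex R) s),
    forall lam, confocal a lam x <-> lam \in s &
    forall j, (j < k + l)%N -> endpoint a j <= s`_j <= endpoint a j.+1].
  move=> inx; have [s [sz_s perm_s s_in]] := jacobi_interlacing R k l a x ha inx.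
  exists s; split=> // lam.
  by rewrite mem_gen_jacobi_real// (perm_mem perm_s) mem_map//; apply: complexI.
(* One list indexes the parameters, the types and the intervals simultaneously. *)
have types x : inside_ellipsoid a x -> ~ discriminant_set a x ->
    exists s : seq R, [/\ size s = (k + l)%N, uniq s,
      forall lam, confocal a lam x <-> lam \in s,
      forall j, (j < k + l)%N -> endpoint a j <= s`_j <= endpoint a j.+1 &
      forall j T, (j < k + l)%N -> type_at a s`_j x T <-> T = EHtype j].
  move=> inx ndisc; have [s [sz_s perm_s s_conf s_in]] := roots x inx.
  have sorted_s := sorted_jacobi R k l a x s sz_s perm_s s_in ndisc.
  exists s; split=> //; first exact: lt_sorted_uniq.
  by move=> j T ltj; apply: jacobi_type.
have nthP lam (s : seq R) : size s = (k + l)%N -> lam \in s ->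
    exists2 j, (j < k + l)%N & lam = s`_j.
  by move=> sz_s /(nthP 0)[j]; rewrite sz_s; exists j.
split=> [x inx|x inx ndisc].
  split=> [|ndisc].
    have [s [/eqP sz_s perm_s s_conf _]] := roots x inx.
    by exists (Tuple sz_s).
  have [s [sz_s us s_conf s_in s_type]] := types x inx ndisc.
  split=> [|lam /s_conf lam_s|lam mu T /s_conf lam_s /s_conf mu_s].
  - have -> : [set Q | range (confocal a) Q /\ Q x] =
        [set confocal a s`_j | j in `I_(k + l)].
      apply/seteqP; split=> [Q [[lam _ <-]] /s_conf/(nthP _ _ sz_s)[j ltj ->]|].
        by exists j.
      move=> _ [j /= ltj <-]; split; first by exists s`_j.
      by apply/s_conf; rewrite mem_nth ?sz_s.
    (* The quadrics are counted as sets of points, so distinct roots must be shown to give distinct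
       sets. *)
    apply: inj_card_eq => i j; rewrite !inE /= => lti ltj /confocal_inj eq_s.
    by apply/eqP; rewrite -(nth_uniq 0 _ _ us) ?sz_s// eq_s.
  - have [j ltj ->] := nthP _ _ sz_s lam_s.
    by exists (EHtype j); split=> [|T /s_type->//]; apply/s_type.
  have [i lti ->] := nthP _ _ sz_s lam_s; have [j ltj ->] := nthP _ _ sz_s mu_s.
  by move=> /s_type-> // /s_type/EHtype_inj->.
have [s [sz_s us s_conf s_in s_type]] := types x inx ndisc; split.
  apply/seteqP; split=> [T [lam /s_conf/(nthP _ _ sz_s)[j ltj ->]]|_ [j ltj <-]].
    by move=> /s_type-> //; exists j.
  by exists s`_j; [apply/s_conf; rewrite mem_nth ?sz_s | apply/s_type].
move=> j lam ltj lam_x.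
have [i lti def_lam] := nthP _ _ sz_s ((s_conf lam).1 lam_x).
have le_lam : type_at a lam x (EHtype j) -> endpoint a j <= lam <= endpoint a j.+1.
  by rewrite def_lam => /s_type/EHtype_inj-> //; apply: s_in.
split=> // ndeg; split=> [/le_lam/andP[le1 le2]|/andP[lt1 lt2]].
  (* The endpoint 0 is excluded because the polynomial is negative there inside the ellipsoid, the
     other endpoints because they are degenerate parameters. *)
  have neq n : (n <= k + l)%N -> endpoint a n != lam.
    move=> len; apply/eqP; have [->|[m _ ->]] := endpointP R k l a n len.
      rewrite endpoint_zero => lam0.
      have := confocal_poly0_lt0 R k l a x ha inx.
      by move: lam_x; rewrite confocalE// /root -lam0 => /eqP->; rewrite ltxx.
    by move=> eq_lam; apply: ndeg; exists m.
  by rewrite !lt_neqAle le1 le2 neq ?(ltnW ltj)// eq_sym neq.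
(* Here [lam] lies in the closed interval number [i] and in the open interval number [j], and these
   are disjoint unless [i = j]. *)
rewrite def_lam; apply/s_type => //; congr EHtype.
have /andP[le1 le2] := s_in i lti; rewrite -def_lam in le1 le2.
have mono m n : (m < n <= k + l)%N -> endpoint a m < endpoint a n.
  elim: n => // n IHn /andP[]; rewrite ltnS leq_eqVlt => /orP[/eqP->|ltm] len.
    exact: endpoint_lt.
  by rewrite (lt_trans (IHn _)) ?endpoint_lt// ltm ltnW.
have le_mono m n : (m <= n <= k + l)%N -> endpoint a m <= endpoint a n.
  by rewrite leq_eqVlt => /andP[/orP[/eqP->//|ltm] len]; rewrite ltW// mono ?ltm.
apply/eqP; rewrite eqn_leq; apply/andP; split; rewrite leqNgt; apply/negP => lt_ij.
  have := le_mono i.+1 j; rewrite lt_ij (ltnW ltj) => /(_ isT) le_ij.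
  by have := le_lt_trans le_ij lt1; rewrite ltNge le2.
have := le_mono j.+1 i; rewrite lt_ij (ltnW lti) => /(_ isT) le_ji.
by have := lt_le_trans lt2 le_ji; rewrite ltNge le1.
Qed.
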